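(* For all integers $m,n$ with $2\leq m\leq n$, the rectangular grid $P_m\times P_n$ satisfies $$\sigma_T(P_m\times P_n)=2\left\lfloor\frac{m}{2}\right\rfloor+1.$$
   Context: All graphs are finite and simple. For a connected graph $G$ (with at least one edge) and a spanning tree $T$ of $G$, let $d_T(u,v)$ be the distance between $u$ and $v$ in $T$. The stretch of $T$ is $\sigma_T(G,T):=\max_{uv\in E(G)} d_T(u,v)$, and the tree-stretch of $G$ is $\sigma_T(G):=\min\{\sigma_T(G,T): T \text{ is a spanning tree of } G\}$ (the subscript $T$ in $\sigma_T(G)$ is part of the notation and does not refer to a particular tree). The rectangular grid $P_m\times P_n$ is the graph with vertex set $\{(i,j):1\leq i\leq m,\ 1\leq j\leq n\}$ in which $(i,j)$ and $(i',j')$ are adjacent if and only if $|i-i'|+|j-j'|=1$. *)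

(* Defs.v *)
From mathcomp Require Import all_boot ssrint.

Set Implicit Arguments.
Unset Strict Implicit.
Unset Printing Implicit Defensive.

Record sgraph := SGraph {
  vertex :> finType;
  adj : rel vertex;
  adj_sym : symmetric adj;
  adj_irr : irreflexive adj }.

Section Relations.
Variables (V : finType) (r : rel V).

Definition walk_of_length (k : nat) (x y : V) : bool :=
  [exists p : k.-tuple V, path r x p && (last x p == y)].

(* A shortest walk repeats no vertex, so it has fewer than #|V| edges; the
   value is #|V| exactly when y is not reachable from x. *)
Definition dist (x y : V) : nat :=
  \big[minn/#|V|]_(k < #|V| | walk_of_length k x y) k.

Definition connected : bool := [forall x, forall y, connect r x y].

(* For a symmetric irreflexive r, duplicate-free cyclic sequences of size 2 are
   single edges traversed back and forth; those of size at least 3 are the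
   cycles of the graph. *)
Definition acyclic : bool :=
  [forall c : #|V|.-bseq V, ucycleb r c ==> (size c <= 2)].

Definition is_tree : bool := connected && acyclic.

End Relations.

Section TreeStretch.
Variable G : sgraph.

Definition edges : {set {set G}} :=
  [set [set p.1; p.2] | p : G * G & adj p.1 p.2].

Definition edge_rel (F : {set {set G}}) : rel G :=
  fun x y => [set x; y] \in F.

(* Spanning trees have all of G as vertex set, so they are given by their sets
   of edges. *)
Definition spanning_tree (F : {set {set G}}) : bool :=
  (F \subset edges) && is_tree (edge_rel F).

Definition stretch (F : {set {set G}}) : nat :=
  \max_(p : G * G | adj p.1 p.2) dist (edge_rel F) p.1 p.2.

(* The default value #|G| is an upper bound of every stretch, so this is the
   true minimum whenever G has a spanning tree: see [tree_stretchP]. *)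
Definition tree_stretch : nat :=
  \big[minn/#|G|]_(F : {set {set G}} | spanning_tree F) stretch F.

End TreeStretch.

Lemma bigmin_leq (I : finType) (d : nat) (P : pred I) (f : I -> nat) (i : I) :
  P i -> \big[minn/d]_(j | P j) f j <= f i.
Proof.
move=> Pi; rewrite -big_filter.
have: i \in [seq j <- index_enum I | P j] by rewrite mem_filter Pi mem_index_enum.
elim: [seq j <- _ | _] => //= a s IH; rewrite inE big_cons geq_min.
by case/orP => [/eqP->|/IH->]; rewrite ?leqnn ?orbT.
Qed.

Lemma bigmin_attained (I : finType) (d : nat) (P : pred I) (f : I -> nat)
    (i : I) :
  P i -> (forall j, P j -> f j <= d) ->
  exists2 j, P j & f j = \big[minn/d]_(j | P j) f j.
Proof.
move=> Pi fd; case: (arg_minnP f Pi) => j Pj jmin.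
exists j => //; apply/eqP; rewrite eqn_leq bigmin_leq // andbT.
apply: (big_ind (fun k => f j <= k)); [exact: fd| |exact: jmin].
by move=> a b ja jb; rewrite leq_min ja.
Qed.

Lemma dist_leq_card (V : finType) (r : rel V) (x y : V) : dist r x y <= #|V|.
Proof.
apply: (big_ind (fun k => k <= #|V|)) => // [a b ha _|i _].
  by rewrite geq_min ha.
exact: ltnW.
Qed.

Lemma dist_leq (V : finType) (r : rel V) (x : V) (p : seq V) :
  path r x p -> dist r x (last x p) <= size p.
Proof.
move=> rp; have [sp|] := ltnP (size p) #|V|; last exact/leq_trans/dist_leq_card.
apply: (bigmin_leq _ _ (i := Ordinal sp)).
by apply/existsP; exists (in_tuple p); rewrite rp eqxx.
Qed.

Lemma dist_attained (V : finType) (r : rel V) (x y : V) :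
  connect r x y ->
  exists p, [/\ path r x p, last x p = y & size p = dist r x y].
Proof.
case/connectP => p0 rp0 ->; case/shortenP: rp0 => p rp up _.
have sp : size p < #|V| by rewrite -[(size p).+1]/(size (x :: p)) -(card_uniqP up) max_card.
have Pk : walk_of_length r (Ordinal sp) x (last x p).
  by apply/existsP; exists (in_tuple p); rewrite rp eqxx.
have [k|k /existsP[q /andP[rq /eqP lq]] kE] :=
  @bigmin_attained _ #|V| (fun k : 'I_#|V| => walk_of_length r k x (last x p))
      (fun k => k) _ Pk.
  by move=> _; apply: ltnW.
by exists q; split=> //; rewrite size_tuple.
Qed.

Lemma tree_stretchP (G : sgraph) (F0 : {set {set G}}) :
  spanning_tree F0 ->
  (exists2 F : {set {set G}}, spanning_tree F & stretch F = tree_stretch G) /\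
  (forall F : {set {set G}}, spanning_tree F -> tree_stretch G <= stretch F).
Proof.
move=> F0P; split=> [|F FP]; last exact: bigmin_leq.
apply: bigmin_attained F0P _ => F _.
by apply/bigmax_leqP => p _; apply: dist_leq_card.
Qed.

Section Grid.
Variables m n : nat.

(* Coordinates are numbered from 0 instead of from 1. *)
Definition grid_adj : rel ('I_m * 'I_n) :=
  fun x y => (`|(x.1 : nat) - y.1| + `|(x.2 : nat) - y.2| == 1)%N.

Lemma grid_adj_sym : symmetric grid_adj.
Proof. by move=> x y; rewrite /grid_adj distnC (distnC x.2). Qed.

Lemma grid_adj_irr : irreflexive grid_adj.
Proof. by move=> x; rewrite /grid_adj !distnn. Qed.

Definition grid : sgraph := SGraph grid_adj_sym grid_adj_irr.

End Grid.

(* Main.v *)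
Require Import Defs.
From mathcomp Require Import all_boot.
From mathcomp Require Import zify.

(** Put k = m %/ 2, so that both sides of the grid have at least 2k vertices.

    Upper bound.  The comb whose spine is the line xpos = k and whose teeth are
    the lines perpendicular to it has stretch at most 2k + 1: every point is at
    distance at most k from the spine, so two adjacent points of neighbouring
    teeth are joined by going to the spine, one step along it, and back
    ([comb_stretch]).

    Lower bound.  Let T be a spanning tree, and let Q be the unit face with
    corners (k-1, k-1) and (k, k), the central face of the square
    [0, 2k-1] x [0, 2k-1].  The boundary of that square winds once around Q.
    Replace each of its edges uv by the path of T from u to v: the result is a
    closed walk in a tree, which winds around nothing.  Hence, for some boundary
    edge uv, the fundamental cycle of uv encloses Q.  That cycle meets the ray
    which leaves Q away from the side of the square containing uv, so the path
    of T goes from u to an edge beyond the centre and comes back: it takes at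
    least k steps to get there, one step to cross the ray and k steps to
    return, 2k + 1 in all.

    Winding is measured modulo 2, as the parity of the number of crossings of a
    ray from the centre of Q.  Three facts carry the argument:
    - a closed walk in an acyclic graph crosses evenly ([closed_walk_parity]);
    - two rays from Q give the same parity on closed walks, since together they
      bound a quadrant or a half-plane, which a closed walk enters as often as
      it leaves ([walk_parity_coboundary], [crossNS], [crossNE], [crossNW]), so
      the ray can be chosen according to the side ([side_detour_parity]);
    - a walk between adjacent points of a side that crosses the far ray is
      long ([short_walk_parity]). *)

Set Implicit Arguments.
Unset Strict Implicit.
Unset Printing Implicit Defensive.

(** * Crossing parity of walks *)

Section WalkParity.
Variables (V : finType) (r : rel V).
Implicit Types (w : V -> V -> bool) (x y : V) (p : seq V).

Fixpoint walk_parity w x p : bool :=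
  if p is y :: p' then w x y (+) walk_parity w y p' else false.

Lemma walk_parity_cat w x p q :
  walk_parity w x (p ++ q) = walk_parity w x p (+) walk_parity w (last x p) q.
Proof. by elim: p x => //= y p IH x; rewrite IH addbA. Qed.

Lemma not_uniq_split p :
  ~~ uniq p -> exists z p1 p2 p3, p = p1 ++ z :: p2 ++ z :: p3.
Proof.
elim: p => //= x p IH; rewrite negb_and negbK => /orP[|/IH].
  by case/splitPr=> p2 p3; exists x, [::], p2, p3.
by case=> z [p1 [p2 [p3 ->]]]; exists z, (x :: p1), p2, p3.
Qed.

(** A closed walk that repeats a vertex is made of two shorter closed walks; one
    that does not is a cycle, so acyclicity leaves only an edge traversed back
    and forth, which is counted twice. *)
Lemma closed_walk_parity w x p :
  irreflexive r -> acyclic r -> (forall a b, r a b -> w a b = w b a) ->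
  path r x p -> last x p = x -> walk_parity w x p = false.
Proof.
move=> irr /forallP acy wsym.
have [N] := ubnP (size p); elim: N x p => // N IH x p szp rp lp.
have [up | /not_uniq_split[z [p1 [p2 [p3 pE]]]]] := boolP (uniq p); last first.
  move: rp lp szp; rewrite pE !cat_path /= !cat_path /= last_cat /= last_cat /=.
  case/and5P=> rp1 r1z rp2 r2z rp3 lp szp.
  (* Cut at the repeated vertex z: the loop from z to z, and what remains. *)
  have zz : walk_parity w z (rcons p2 z) = false.
    apply: IH; rewrite ?last_rcons ?rcons_path ?rp2 //.
    by rewrite size_rcons; move: szp; rewrite !size_cat /= size_cat /=; lia.
  have xx : walk_parity w x (p1 ++ z :: p3) = false.
    apply: IH; rewrite ?cat_path ?last_cat /= ?rp1 ?r1z //.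
    by move: szp; rewrite !size_cat /= size_cat /=; lia.
  move: zz xx; rewrite -cats1 !walk_parity_cat /= walk_parity_cat /= addbF.
  by move=> zz; rewrite (addbA (walk_parity w z p2)) zz.
have szV : size p <= #|V| by rewrite -(card_uniqP up) max_card.
have cp : cycle r p.
  case: p {IH szp up szV} rp lp => //= y p /andP[rxy rp] lp.
  by rewrite rcons_path rp lp.
have /implyP/(_ _)/= := acy (Bseq szV); rewrite /ucycleb cp up => /(_ isT).
case: p {IH szp up szV cp} rp lp => [|y [|z []]] //=.
  by rewrite andbT => rxy yx; rewrite yx irr in rxy.
by case/andP=> rxy _ -> _; rewrite (wsym _ _ rxy) addbF addbb.
Qed.

Lemma walk_lipschitz (h : V -> nat) x p :
  (forall a b, r a b -> h a <= (h b).+1 /\ h b <= (h a).+1) ->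
  path r x p -> h x <= h (last x p) + size p /\ h (last x p) <= h x + size p.
Proof.
move=> lip; elim: p x => [|y p IH] x /=; first by rewrite addn0.
by case/andP=> /lip[xy yx] /IH[]; lia.
Qed.

Lemma odd_walk_crosses w x p :
  walk_parity w x p -> exists p1 b p2, p = p1 ++ b :: p2 /\ w (last x p1) b.
Proof.
elim: p x => //= y p IH x; have [wxy _|_] := boolP (w x y).
  by exists [::], y, p.
by case/IH=> p1 [b [p2 [-> wb]]]; exists (y :: p1), b, p2.
Qed.

(** With h a coordinate and w the crossings of a ray, the hypothesis on w says
    that the ray is k away from u and v in that coordinate.  A walk that reaches
    the ray then has k steps before the crossing and k steps after it. *)
Lemma short_walk_parity (h : V -> nat) w k u v p :
  (forall a b, r a b -> h a <= (h b).+1 /\ h b <= (h a).+1) ->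
  (forall a b, w a b ->
     (h u + k <= h a /\ h v + k <= h b) \/ (h a + k <= h u /\ h b + k <= h v)) ->
  path r u p -> last u p = v -> size p < 2 * k + 1 -> walk_parity w u p = false.
Proof.
move=> lip far rp lp sp; apply/negP=> /odd_walk_crosses[p1 [b [p2 [pE wb]]]].
move: rp lp sp; rewrite pE cat_path last_cat size_cat /=.
case/and3P=> /(walk_lipschitz lip)[ua au] _ /(walk_lipschitz lip)[bv vb] lp sp.
by rewrite lp in bv vb; have [[]|[]] := far _ _ wb; lia.
Qed.

(** When w1 and w2 together count the passages through the boundary of the
    region chi, their total telescopes. *)
Lemma walk_parity_coboundary w1 w2 (chi : V -> bool) x p :
  (forall a b, r a b -> w1 a b (+) w2 a b = chi a (+) chi b) ->
  path r x p ->
  walk_parity w1 x p (+) walk_parity w2 x p = chi x (+) chi (last x p).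
Proof.
move=> cob; elim: p x => [|y p IH] x /=; first by rewrite addbb.
case/andP=> /cob cxy /IH; rewrite addbACA cxy => ->.
by rewrite addbA addbK.
Qed.

End WalkParity.

(** * Spanning trees given by a parent function *)

Section ParentTree.
Variables (G : sgraph) (root : G) (par : G -> G) (rk : G -> nat).
Hypothesis par_adj : forall x, x != root -> adj x (par x).
Hypothesis par_root : par root = root.
Hypothesis par_rk : forall x, x != root -> rk (par x) < rk x.

Definition parent_edges : {set {set G}} :=
  [set [set x; par x] | x in [set~ root]].

Local Notation r := (edge_rel parent_edges).

Lemma set2_eqP (a b x y : G) : [set a; b] = [set x; y] ->
  (a = x /\ b = y) \/ (a = y /\ b = x).
Proof.
move=> E; have: a \in [set x; y] by rewrite -E set21.
have: b \in [set x; y] by rewrite -E set22.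
have: x \in [set a; b] by rewrite E set21.
have: y \in [set a; b] by rewrite E set22.
by rewrite !inE; do 4!case/orP=> /eqP ?; subst; auto.
Qed.

Lemma parent_edgeP x y : r x y ->
  (x != root /\ y = par x) \/ (y != root /\ x = par y).
Proof.
by case/imsetP=> z; rewrite !inE => nz /set2_eqP[[-> ->]|[-> ->]]; [left|right].
Qed.

Lemma parent_edge x : x != root -> r x (par x).
Proof. by move=> nx; apply/imsetP; exists x; rewrite ?inE. Qed.

Lemma edge_rel_sym (F : {set {set G}}) : symmetric (edge_rel F).
Proof. by move=> x y; rewrite /edge_rel setUC. Qed.

Lemma parent_connect_root x : connect r x root.
Proof.
have [N] := ubnP (rk x); elim: N x => // N IH x lt.
have [->|nx] := eqVneq x root; first exact: connect0.
apply: connect_trans (connect1 (parent_edge nx)) (IH _ _).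
by have := par_rk nx; lia.
Qed.

(** In a cycle, both neighbours of a vertex of maximal rank have to be its
    parent, so they coincide and the cycle has at most two vertices. *)
Lemma parent_acyclic : acyclic r.
Proof.
apply/forallP=> c; apply/implyP; case/andP; case: c => /= c _ cc uc.
case: c cc uc => // x0 c0; set c := x0 :: c0 => cc uc.
have [x xc xmax] : exists2 x, x \in c & forall y, y \in c -> rk y <= rk x.
  by case: (@arg_maxnP _ x0 (mem c) rk (mem_head _ _)) => x; exists x.
have [i c' rotE] := rot_to xc.
move: (uc) (cc); rewrite -(rot_uniq i) -(rot_cycle i r) -(size_rot i c) rotE /=.
have next_par y : y \in c' -> r x y -> y = par x.
  move=> yc' /parent_edgeP[[] //|[ny xE]].
  have /xmax : y \in c by rewrite -(mem_rot i) rotE inE yc' orbT.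
  by have := par_rk ny; rewrite -xE; lia.
case: c' next_par {rotE} => // y c' next_par /=.
case/and3P=> _ yc' _ /andP[rxy]; rewrite rcons_path edge_rel_sym => /andP[_ rlx].
case: c' yc' next_par rlx => // z c' yc' next_par rlx.
have yE := next_par _ (mem_head _ _) rxy.
have lE : last y (z :: c') = par x by apply: next_par; rewrite ?mem_last.
by move: yc'; rewrite yE -lE /= mem_last.
Qed.

Lemma parent_spanning_tree : spanning_tree parent_edges.
Proof.
apply/and3P; split; last exact: parent_acyclic.
  apply/subsetP=> e /imsetP[x]; rewrite !inE => nx ->.
  by apply/imsetP; exists (x, par x); rewrite ?inE ?par_adj.
apply/forallP=> x; apply/forallP=> y.
apply: connect_trans (parent_connect_root x) _.
by rewrite (sym_connect_sym (edge_rel_sym _)) parent_connect_root.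
Qed.

(** The bound is an inequality because the parent of the root is the root: the
    iteration stalls there. *)
Lemma iter_parent_walk k x :
  exists2 p, path r x p & last x p = iter k par x /\ size p <= k.
Proof.
elim: k x => [|k IH] x; first by exists [::].
have [p rp [lp sp]] := IH (par x); rewrite iterSr.
have [xr|nx] := eqVneq x root.
  by exists p; [move: rp|move: lp]; rewrite xr par_root // => ->; split=> //; lia.
by exists (par x :: p); rewrite /= ?parent_edge.
Qed.

Lemma dist_common_ancestor i j x y :
  iter i par x = iter j par y -> dist r x y <= i + j.
Proof.
have [p rp [lp sp]] := iter_parent_walk i x.
have [q rq [lq sq]] := iter_parent_walk j y.
move=> E; move: rq; rewrite (eq_path (e' := fun a b => r b a)); last first.
  by move=> a b; apply: edge_rel_sym.
rewrite -rev_path lq -E -lp => rq.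
have -> : y = last x (p ++ rev (belast y q)).
  rewrite last_cat lp E -lq -(last_cons y) -rev_rcons -lastI rev_cons.
  by rewrite last_rcons.
apply: leq_trans (dist_leq _) _; first by rewrite cat_path rp.
by rewrite size_cat size_rev size_belast leq_add.
Qed.

End ParentTree.

(** * Grid coordinates *)

Section GridCoordinates.
Variables m n : nat.
Implicit Types a b : grid m n.

Definition xpos a : nat := a.1.
Definition ypos a : nat := a.2.

Lemma xpos_lt a : xpos a < m. Proof. exact: ltn_ord. Qed.
Lemma ypos_lt a : ypos a < n. Proof. exact: ltn_ord. Qed.

Lemma pos_inj a b : xpos a = xpos b -> ypos a = ypos b -> a = b.
Proof. by case: a b => [? ?] [? ?] /val_inj /= -> /val_inj /= ->. Qed.

Lemma grid_adjE a b : adj a b <->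
  (xpos a = xpos b /\ (ypos b = (ypos a).+1 \/ ypos a = (ypos b).+1)) \/
  (ypos a = ypos b /\ (xpos b = (xpos a).+1 \/ xpos a = (xpos b).+1)).
Proof.
by rewrite /adj /= /grid_adj -/(xpos a) -/(xpos b) -/(ypos a) -/(ypos b); lia.
Qed.

End GridCoordinates.

(** * Rays from the central face *)

Section GridCrossing.
Variables m n k : nat.
Local Notation V := (grid m n).
Implicit Types (a b u v : V).

Definition east a := k <= xpos a.
Definition north a := k <= ypos a.

(** The edges crossed by the four axis-parallel rays that start at the centre of
    the face with corners (k-1, k-1) and (k, k). *)
Definition crossN a b := (east a (+) east b) && (north a && north b).
Definition crossS a b := (east a (+) east b) && ~~ (north a || north b).
Definition crossE a b := (north a (+) north b) && (east a && east b).
Definition crossW a b := (north a (+) north b) && ~~ (east a || east b).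

Lemma adj_quadrant a b :
  adj a b -> ~~ ((east a (+) east b) && (north a (+) north b)).
Proof.
move/grid_adjE; rewrite /east /north.
by case=> [[-> _]|[-> _]]; rewrite addbb ?andbF.
Qed.

(** The north and south rays form the line between the east and west
    half-planes. *)
Lemma crossNS a b : adj a b -> crossN a b (+) crossS a b = east a (+) east b.
Proof.
move/adj_quadrant; rewrite /crossN /crossS.
by case: (east a) (east b) (north a) (north b) => [] [] [] [].
Qed.

(** The north and east rays bound the north-east quadrant. *)
Lemma crossNE a b : adj a b ->
  crossN a b (+) crossE a b = (east a && north a) (+) (east b && north b).
Proof.
move/adj_quadrant; rewrite /crossN /crossE.
by case: (east a) (east b) (north a) (north b) => [] [] [] [].
Qed.

Lemma crossNW a b : adj a b ->
  crossN a b (+) crossW a b = (~~ east a && north a) (+) (~~ east b && north b).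
Proof.
move/adj_quadrant; rewrite /crossN /crossW.
by case: (east a) (east b) (north a) (north b) => [] [] [] [].
Qed.

(** Both points lie on the line through one side of the square
    [0, 2k-1] x [0, 2k-1]. *)
Definition on_side u v :=
  [\/ xpos u = 0 /\ xpos v = 0, xpos u = (2 * k).-1 /\ xpos v = (2 * k).-1,
      ypos u = 0 /\ ypos v = 0 | ypos u = (2 * k).-1 /\ ypos v = (2 * k).-1].

(** For each side, the north ray is traded for the ray that points away from that
    side; a short walk does not reach it, and neither does the edge uv. *)
Lemma side_detour_parity u v p : 0 < k -> adj u v -> on_side u v ->
  path (@adj V) u p -> last u p = v -> size p < 2 * k + 1 ->
  walk_parity crossN u p = crossN u v.
Proof.
move=> k0 uv side pp lp sp.
have lip1 a b : adj a b -> xpos a <= (xpos b).+1 /\ xpos b <= (xpos a).+1.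
  by move/grid_adjE; lia.
have lip2 a b : adj a b -> ypos a <= (ypos b).+1 /\ ypos b <= (ypos a).+1.
  by move/grid_adjE; lia.
have reduce w (chi : V -> bool) (h : V -> nat) :
    (forall a b, adj a b -> h a <= (h b).+1 /\ h b <= (h a).+1) ->
    (forall a b, adj a b -> crossN a b (+) w a b = chi a (+) chi b) ->
    (forall a b, w a b -> (h u + k <= h a /\ h v + k <= h b) \/
                          (h a + k <= h u /\ h b + k <= h v)) ->
    walk_parity crossN u p = crossN u v.
  move=> lip cob far; have := walk_parity_coboundary cob pp.
  rewrite lp -cob // (short_walk_parity lip far pp lp sp).
  have -> : w u v = false by apply/negP=> /far; lia.
  by rewrite !addbF.
case: side => [] [u0 v0].
- apply: (reduce crossE _ (@xpos m n) lip1 crossNE) => a b.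
  by rewrite /crossE /east u0 v0; lia.
- apply: (reduce crossW _ (@xpos m n) lip1 crossNW) => a b.
  by rewrite /crossW /east u0 v0; lia.
- apply: (reduce crossN (fun=> false) (@ypos m n) lip2) => a b.
    by rewrite addbb.
  by rewrite /crossN /north u0 v0; lia.
- apply: (reduce crossS _ (@ypos m n) lip2 crossNS) => a b.
  by rewrite /crossS /north u0 v0; lia.
Qed.

End GridCrossing.

(** * Lower bound *)

Section GridLowerBound.
Variables (m' n' k : nat) (T : rel (grid m'.+1 n'.+1)).
Local Notation V := (grid m'.+1 n'.+1).
Hypotheses (k0 : 0 < k) (km : 2 * k <= m'.+1) (kn : 2 * k <= n'.+1).
Hypotheses (Tadj : subrel T (@adj V)) (Tacy : acyclic T).

(** If all tree paths joining adjacent points were short, those replacing the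
    edges of the square's boundary would have the same crossing parities as these
    edges.  Their concatenation would be a closed walk of odd parity, since the
    boundary crosses the north ray only once, on its top side. *)
Lemma long_fundamental_cycle :
  ~ (forall u v : V, adj u v ->
       exists p, [/\ path T u p, last u p = v & size p < 2 * k + 1]).
Proof.
move=> short.
pose joined (c : bool) (u v : V) :=
  exists p, [/\ path T u p, last u p = v & walk_parity (crossN k) u p = c].
have joined_trans c d u v w : joined c u v -> joined d v w -> joined (c (+) d) u w.
  case=> p [rp lp wp] [q [rq lq wq]]; exists (p ++ q).
  by rewrite cat_path last_cat walk_parity_cat lp rp wp wq.
have side_joined u v : adj u v -> on_side k u v -> joined (crossN k u v) u v.
  move=> uv side; have [p [rp lp sp]] := short u v uv.
  exists p; split=> //; apply: side_detour_parity sp => //.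
  exact: sub_path rp.
have chain (f : nat -> V) (chi : V -> bool) N :
    (forall i, i < N -> [/\ adj (f i) (f i.+1), on_side k (f i) (f i.+1) &
       crossN k (f i) (f i.+1) = chi (f i) (+) chi (f i.+1)]) ->
    joined (chi (f 0) (+) chi (f N)) (f 0) (f N).
  elim: N => [|N IH] step; first by exists [::]; rewrite addbb.
  have [fa fs fc] := step N (ltnSn N).
  rewrite -[chi (f 0)](addbK (chi (f N))) -addbA -fc.
  by apply: joined_trans (side_joined _ _ fa fs); apply: IH => i iN; apply: step; lia.
pose t := (2 * k).-1.
pose pt i j : V := (inord i, inord j).
have pt1 i j : i <= t -> xpos (pt i j) = i by move=> it; rewrite /xpos /= inordK; lia.
have pt2 i j : j <= t -> ypos (pt i j) = j by move=> jt; rewrite /ypos /= inordK; lia.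
have pt_adj i j i' j' : i <= t -> j <= t -> i' <= t -> j' <= t ->
    (i = i' /\ (j' = j.+1 \/ j = j'.+1)) \/ (j = j' /\ (i' = i.+1 \/ i = i'.+1)) ->
    adj (pt i j) (pt i' j').
  by move=> it jt it' jt' ?; apply/grid_adjE; rewrite !pt1 ?pt2.
have ptE i j : i <= t -> east k (pt i j) = (k <= i).
  by move=> it; rewrite /east (pt1 i j it).
have ptN i j : j <= t -> north k (pt i j) = (k <= j).
  by move=> jt; rewrite /north (pt2 i j jt).
have bottom : joined false (pt 0 0) (pt t 0).
  apply: (chain (fun i => pt i 0) (fun=> false)) => i it; split.
  - by apply: pt_adj; lia.
  - by constructor 3; rewrite !pt2.
  - by rewrite /crossN !ptN // leqNgt k0 andbF.
have right : joined false (pt t 0) (pt t t).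
  apply: (chain (fun j => pt t j) (fun=> false)) => j jt; split.
  - by apply: pt_adj; lia.
  - by constructor 2; rewrite !pt1.
  - by rewrite /crossN !ptE // addbb.
have top : joined true (pt t t) (pt 0 t).
  have := chain (fun i => pt (t - i) t) (east k) t.
  rewrite subn0 subnn !ptE //.
  have -> : (k <= t) (+) (k <= 0) by rewrite /t; lia.
  apply=> i it; split.
  - by apply: pt_adj; lia.
  - by constructor 4; rewrite !pt2.
  - rewrite /crossN !ptN //; have -> : k <= t by rewrite /t; lia.
    by rewrite !andbT.
have left : joined false (pt 0 t) (pt 0 0).
  have := chain (fun j => pt 0 (t - j)) (fun=> false) t.
  rewrite subn0 subnn; apply=> j jt; split.
  - by apply: pt_adj; lia.
  - by constructor 1; rewrite !pt1.
  - by rewrite /crossN !ptE // addbb.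
have [p [rp lp]] :=
  joined_trans _ _ _ _ _ (joined_trans _ _ _ _ _ bottom right)
    (joined_trans _ _ _ _ _ top left).
rewrite (closed_walk_parity _ Tacy _ rp lp) //.
  by move=> x; apply/negP=> /Tadj; rewrite adj_irr.
by move=> a b _; rewrite /crossN addbC [X in _ && X]andbC.
Qed.

End GridLowerBound.

Lemma grid_stretch_lower m n k (F : {set {set grid m n}}) :
  0 < k -> 2 * k <= m -> 2 * k <= n -> spanning_tree F -> 2 * k + 1 <= stretch F.
Proof.
case: m n F => [|m] [|n] F k0 km kn; try lia.
case/and3P=> sub con acy; rewrite leqNgt; apply/negP=> lt.
apply: (long_fundamental_cycle k0 km kn _ acy) => [a b /(subsetP sub)|u v uv].
  case/imsetP=> [[x y]]; rewrite inE => xy /set2_eqP[] [-> ->] //.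
  by rewrite adj_sym.
have /forallP/(_ u)/forallP/(_ v)/dist_attained[p [rp lp sp]] := con.
exists p; split=> //; rewrite sp; apply: leq_ltn_trans lt.
exact: (@leq_bigmax_cond _ _ (fun q : _ * _ => dist (edge_rel F) q.1 q.2) (u, v)).
Qed.

(** * The comb and the upper bound *)

Section Comb.
Variables (m' n' c : nat).
Hypothesis cm : c <= m'.
Local Notation V := (grid m'.+1 n'.+1).

Definition toward_spine i := if i < c then i.+1 else i.-1.

Definition comb_root : V := (inord c, ord0).
Definition comb_parent (x : V) : V :=
  if xpos x == c then (x.1, inord (ypos x).-1)
  else (inord (toward_spine (xpos x)), x.2).
(** This is the distance to the root in the comb: to the spine, then along it. *)
Definition comb_rank (x : V) : nat := (c - xpos x) + (xpos x - c) + ypos x.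

Lemma comb_parent1 x :
  xpos (comb_parent x) = if xpos x == c then xpos x else toward_spine (xpos x).
Proof.
rewrite /comb_parent; case: ifP => //= xc.
by rewrite /xpos /= inordK // -/(xpos x) /toward_spine; have := xpos_lt x; case: ifP; lia.
Qed.

Lemma comb_parent2 x :
  ypos (comb_parent x) = if xpos x == c then (ypos x).-1 else ypos x.
Proof.
rewrite /comb_parent; case: ifP => //= xc.
by rewrite /ypos /= inordK // -/(ypos x); have := ypos_lt x; lia.
Qed.

Lemma comb_rootE x : x = comb_root <-> xpos x = c /\ ypos x = 0.
Proof.
have r1 : xpos comb_root = c by rewrite /xpos inordK.
by split=> [->//|[x1 x2]]; apply: pos_inj; rewrite ?r1 ?x1 ?x2.
Qed.

Lemma comb_not_root x : x != comb_root -> xpos x != c \/ 0 < ypos x.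
Proof.
move=> nx; have [x1|] := eqVneq (xpos x) c; last by left.
by right; rewrite lt0n; apply: contraNneq nx => x2; apply/eqP/comb_rootE.
Qed.

Lemma comb_parent_adj x : x != comb_root -> adj x (comb_parent x).
Proof.
move/comb_not_root; move=> nr; apply/grid_adjE; rewrite comb_parent1 comb_parent2.
by move: nr; rewrite /toward_spine; do 2?case: ifP; lia.
Qed.

Lemma comb_parent_root : comb_parent comb_root = comb_root.
Proof.
have /comb_rootE[r1 r2] := erefl comb_root; apply/comb_rootE.
by rewrite comb_parent1 comb_parent2 r1 r2 eqxx.
Qed.

Lemma comb_rank_lt x : x != comb_root -> comb_rank (comb_parent x) < comb_rank x.
Proof.
move/comb_not_root; rewrite /comb_rank comb_parent1 comb_parent2 /toward_spine.
by do 2?case: ifP; lia.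
Qed.

Definition comb := parent_edges comb_root comb_parent.

Lemma comb_spanning_tree : spanning_tree comb.
Proof.
exact: parent_spanning_tree comb_parent_adj comb_rank_lt.
Qed.

Lemma iter_comb_parent d x : (c - xpos x) + (xpos x - c) = d ->
  xpos (iter d comb_parent x) = c /\ ypos (iter d comb_parent x) = ypos x.
Proof.
elim: d x => [|d IH] x dE; first by split=> //=; lia.
have xc : (xpos x == c) = false by lia.
rewrite iterSr; have [|-> ->] := IH (comb_parent x).
  by rewrite comb_parent1 xc /toward_spine; case: ifP; lia.
by rewrite comb_parent2 xc.
Qed.

Lemma comb_stretch k : c <= k -> m' <= c + k -> stretch comb <= 2 * k + 1.
Proof.
move=> ck mk; apply/bigmax_leqP => -[x y] /= xy.
have ancestor := dist_common_ancestor comb_parent_root.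
have along_tooth a b : ypos a = ypos b -> xpos b = (xpos a).+1 ->
    dist (edge_rel comb) a b <= 1 /\ dist (edge_rel comb) b a <= 1.
  move=> E2 E1.
  have [ac|ca] := ltnP (xpos a) c.
    have E : comb_parent a = b.
      by apply: pos_inj; rewrite (comb_parent1, comb_parent2) ?/toward_spine ?ac; case: ifP; lia.
    by split; [apply: (ancestor 1 0) | apply: (ancestor 0 1)].
  have E : comb_parent b = a.
    by apply: pos_inj; rewrite (comb_parent1, comb_parent2) ?/toward_spine; do 2?case: ifP; lia.
  by split; [apply: (ancestor 0 1) | apply: (ancestor 1 0)].
have across_teeth a b : xpos a = xpos b -> ypos b = (ypos a).+1 ->
    dist (edge_rel comb) a b <= 2 * k + 1 /\ dist (edge_rel comb) b a <= 2 * k + 1.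
  move=> E1 E2; pose d := (c - xpos a) + (xpos a - c).
  have dk : d <= k by have := xpos_lt a; rewrite /d; lia.
  have [a1 a2] := iter_comb_parent (erefl d).
  have [|b1 b2] := @iter_comb_parent d b; first by rewrite -E1.
  have E : iter d comb_parent a = iter d.+1 comb_parent b.
    by apply: pos_inj; rewrite iterS ?(comb_parent1, comb_parent2) b1 ?b2 eqxx ?E2.
  by split; [apply: leq_trans (ancestor _ _ _ _ E) _
            |apply: leq_trans (ancestor _ _ _ _ (esym E)) _]; lia.
case: ((grid_adjE x y).1 xy) => [] [E1 [E2|E2]].
- by have [] := across_teeth x y.
- by have [] := across_teeth y x.
- by have [h _] := along_tooth x y E1 E2; apply: leq_trans h _; lia.
- by have [_ h] := along_tooth y x (esym E1) E2; apply: leq_trans h _; lia.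
Qed.

End Comb.

(** * The tree-stretch of the grid *)

Theorem theorem4p1 (m n : nat) (hm : 2 <= m) (hmn : m <= n) :
  tree_stretch (grid m n) = 2 * (m %/ 2) + 1.
Proof.
case: m n hm hmn => [|m] [|n] // hm hmn.
have cm : m.+1 %/ 2 <= m by lia.
have [[F tF <-] best] := tree_stretchP (comb_spanning_tree n cm).
have mc : m <= m.+1 %/ 2 + m.+1 %/ 2 by lia.
have comb_le := comb_stretch n cm (leqnn _) mc; apply/eqP; rewrite eqn_leq.
rewrite (leq_trans (best _ (comb_spanning_tree n cm)) comb_le) /=.
by apply: grid_stretch_lower => //; lia.
Qed.
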